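(* Fix an integer $m\ge 2$ and a bounded open connected subset $\Omega\subset\mathbb{R}^m$. There exist $d=5$ smooth bounded vector fields $V_1,\ldots,V_5$ on $\mathbb{R}^m$ such that the control system \[ \frac{d}{dt}X_t = u^1_tV_1(X_t)+\cdots+u^5_tV_5(X_t),\qquad t\in[0,1], \] is a universal $N$-point interpolator on $\Omega$ for every $N\in\mathbb{N}$.
   Context: A vector field on $\mathbb{R}^m$ is a map $\mathbb{R}^m\to\mathbb{R}^m$; it is bounded if $\sup_{x\in\mathbb{R}^m}\|V(x)\|<\infty$. The controls $u^1,\ldots,u^d$ are real-valued (square-integrable) functions on $[0,1]$; for smooth bounded vector fields the solution of the control system with initial condition $X_0=x$ exists and is unique and is denoted $X^x_t$. The system $\frac{d}{dt}X_t=\sum_{i=1}^d u^i_tV_i(X_t)$ is called a universal $N$-point interpolator on $\Omega$ if for every collection $\{(x_i,y_i)\in\Omega\times\Omega: i=1,\ldots,N\}$ with $x_1,\ldots,x_N$ pairwise distinct and $y_1,\ldots,y_N$ pairwise distinct, there exist controls $u^1,\ldots,u^d$ such that $X^{x_i}_1=y_i$ for all $i=1,\ldots,N$. *)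

(* Defs.v *)
From HB Require Import structures.
From mathcomp Require Import all_boot all_order all_algebra.
From mathcomp Require Import all_classical all_reals all_analysis.
Set Implicit Arguments. Unset Strict Implicit. Unset Printing Implicit Defensive.
Import Order.TTheory GRing.Theory Num.Theory.
Import numFieldNormedType.Exports.
Local Open Scope classical_set_scope.
Local Open Scope ring_scope.

Section Defs.
Variable R : realType.

Definition ebasis (m : nat) (j : 'I_m) : 'rV[R]_m := delta_mx 0 j.

Fixpoint iter_partial (m : nat) (js : seq 'I_m) (f : 'rV[R]_m -> 'rV[R]_m)
  : 'rV[R]_m -> 'rV[R]_m :=
  match js with
  | [::] => f
  | j :: js' => fun x => 'D_(ebasis j) (iter_partial js' f) x
  end.

Definition smooth_field (m : nat) (f : 'rV[R]_m -> 'rV[R]_m) : Prop :=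
  forall js : seq 'I_m,
    continuous (iter_partial js f) /\
    (forall (j : 'I_m) (x : 'rV[R]_m), derivable (iter_partial js f) x (ebasis j)).

Definition bounded_field (m : nat) (f : 'rV[R]_m -> 'rV[R]_m) : Prop :=
  exists M : R, forall x, `|f x| <= M.

Definition sq_integrable01 (u : R -> R) : Prop :=
  measurable_fun `[(0:R), 1] u /\
  (lebesgue_measure).-integrable `[(0:R), 1] (fun s => ((u s) ^+ 2)%:E).

Definition ctrl_rhs (m d : nat) (V : 'I_d -> 'rV[R]_m -> 'rV[R]_m)
  (u : 'I_d -> R -> R) (s : R) (z : 'rV[R]_m) : 'rV[R]_m :=
  \sum_(i < d) u i s *: V i z.

(* X is a (Caratheodory) solution on [0,1] of dX/dt = sum_i u^i_t V_i(X_t),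
   X_0 = x: integral form, componentwise, with integrable right-hand side. *)
Definition is_solution (m d : nat) (V : 'I_d -> 'rV[R]_m -> 'rV[R]_m)
  (u : 'I_d -> R -> R) (x : 'rV[R]_m) (X : R -> 'rV[R]_m) : Prop :=
  forall k : 'I_m,
    (lebesgue_measure).-integrable `[(0:R), 1]
        (fun s => (ctrl_rhs V u s (X s) 0 k)%:E) /\
    forall t : R, 0 <= t <= 1 ->
      X t 0 k = x 0 k + Rintegral lebesgue_measure `[(0:R), t]
                          (fun s => ctrl_rhs V u s (X s) 0 k).

Definition flow_maps_to (m d : nat) (V : 'I_d -> 'rV[R]_m -> 'rV[R]_m)
  (u : 'I_d -> R -> R) (x y : 'rV[R]_m) : Prop :=
  (exists X, is_solution V u x X) /\
  (forall X, is_solution V u x X -> X 1 = y).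

Definition universal_interpolator (m d : nat) (V : 'I_d -> 'rV[R]_m -> 'rV[R]_m)
  (Omega : set 'rV[R]_m) (N : nat) : Prop :=
  forall x y : 'I_N -> 'rV[R]_m,
    (forall i, Omega (x i)) -> (forall i, Omega (y i)) ->
    injective x -> injective y ->
    exists u : 'I_d -> R -> R,
      (forall j, sq_integrable01 (u j)) /\
      (forall i, flow_maps_to V u (x i) (y i)).

End Defs.

(* Main.v *)
(** Three fields suffice.  Each is a shear: it depends only on coordinates along
    which it does not move points, so its flow is [z + s V(z)] and solutions are
    unique for trivial reasons.  Writing [x = (x_0, b)], the fields are
    [T = e_0], [A = (0, exp (-(x_0 + c_k)^2))_k] and [B = exp (-|b|^2) e_0].

    Conjugating [A] by [T] adds [sum_j s_j exp (-(x_0 + c_k + j)^2)] to [b_k].  Up to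
    the factor [exp (-(x_0 + c_k)^2)] this is an arbitrary polynomial in
    [exp (-2 (x_0 + c_k))]; the [c_k] are so far apart that the values [x_0 + c_k]
    differ for different [k], so polynomial interpolation moves [b] by any
    prescribed function of [x_0].

    A generic constant shift of [b] followed by a short run of [B] makes the
    [x_0]-coordinates of [N] distinct points distinct.  Once they are, every [b]
    can be prescribed, in particular so that one run of [B], followed by [T],
    takes each [x_0] to its target. *)

Require Import Defs.
From HB Require Import structures.
From mathcomp Require Import all_boot all_order all_algebra.
From mathcomp Require Import all_classical all_reals all_analysis.
From mathcomp Require Import ring lra.
Set Implicit Arguments. Unset Strict Implicit. Unset Printing Implicit Defensive.
Import Order.TTheory GRing.Theory Num.Theory.
Import numFieldNormedType.Exports.
Local Open Scope classical_set_scope.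
Local Open Scope ring_scope.

(** * Smoothness of elementary fields *)

Section Smooth.
Variables (R : realType) (m : nat).
Implicit Types (f g : 'rV[R]_m -> R) (x v : 'rV[R]_m).

(** A class that contains the entries of the fields and is closed under directional derivatives, so
    that smoothness follows by induction on the number of derivatives. *)
Inductive elementary : ('rV[R]_m -> R) -> Prop :=
| elementary_cst c : elementary (cst c)
| elementary_coord k : elementary (fun x => x 0 k)
| elementaryD f g : elementary f -> elementary g -> elementary (f + g)
| elementaryM f g : elementary f -> elementary g -> elementary (f * g)
| elementary_expR f : elementary f -> elementary (expR \o f).

Lemma elementary_sum (I : finType) (P : pred I) (f : I -> 'rV[R]_m -> R) :
  (forall i, elementary (f i)) -> elementary (\sum_(i | P i) f i).
Proof.
move=> ef; elim/big_rec: _ => [|i g _ eg]; first exact: elementary_cst.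
exact: elementaryD.
Qed.

Lemma elementary_continuous f : elementary f -> continuous f.
Proof.
elim=> [c|k|{}f g _ cf _ cg|{}f g _ cf _ cg|{}f _ cf] x.
- exact: cst_continuous.
- exact: coord_continuous.
- exact: (continuousD (cf x) (cg x)).
- exact: (continuousM (cf x) (cg x)).
- exact: (continuous_comp (cf x) (@continuous_expR R _)).
Qed.

(** Restriction to a line makes the one-variable chain rule for [expR] available. *)
Lemma is_derive_line f x v d :
  is_derive x v f d <-> is_derive (0 : R) 1 (fun h => f (h *: v + x)) d.
Proof.
have eqD : 'D_v f x = 'D_1 (fun h : R => f (h *: v + x)) 0.
  rewrite /derive; set g1 := fun h => h^-1 *: _; set g2 := fun h => h^-1 *: _.
  suff -> : g1 = g2 by [].
  by apply/funext => h; rewrite /g1 /g2 /= addr0 scale0r add0r [_%:A]mulr1.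
split=> -[df <-].
  by split; [exact: (derivable1P f x v).1|rewrite eqD].
by split; [exact: (derivable1P f x v).2|rewrite eqD].
Qed.

Lemma is_derive_expR_comp f x v d :
  is_derive x v f d -> is_derive x v (expR \o f) (expR (f x) * d).
Proof.
move=> /is_derive_line df; apply/is_derive_line.
have := @is_derive1_comp R expR (fun h => f (h *: v + x)) 0 _ d (is_derive_expR _) df.
by rewrite scale0r add0r.
Qed.

Lemma is_derive_coord k x v : is_derive x v (fun y : 'rV[R]_m => y 0 k) (v 0 k).
Proof.
have dv : derivable (id : 'rV[R]_m -> 'rV[R]_m) x v by exact: derivable_id.
apply: DeriveDef; first exact: ((derivable_mxP id x v).1 dv).
by have /matrixP/(_ 0 k) := derive_mx dv; rewrite derive_id mxE.
Qed.

Lemma elementary_derive f v : elementary f ->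
  exists2 f', elementary f' & forall x, is_derive x v f (f' x).
Proof.
elim=> [c|k|{}f g ef [f' ef' df] eg [g' eg' dg]
  |{}f g ef [f' ef' df] eg [g' eg' dg]|{}f ef [f' ef' df]].
- exists (cst 0) => [|x]; [exact: elementary_cst|exact: is_derive_cst].
- exists (cst (v 0 k)) => [|x]; [exact: elementary_cst|exact: is_derive_coord].
- exists (f' + g') => [|x]; [exact: elementaryD|exact: is_deriveD].
- exists (f * g' + g * f') => [|x]; last exact: is_deriveM.
  by apply: elementaryD; apply: elementaryM.
- exists ((expR \o f) * f') => [|x]; last exact: is_derive_expR_comp.
  by apply: elementaryM => //; apply: elementary_expR.
Qed.

Definition elementary_field (F : 'rV[R]_m -> 'rV[R]_m) :=
  forall k, elementary (fun x => F x 0 k).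

Lemma elementary_field_derivable F x v : elementary_field F -> derivable F x v.
Proof.
move=> eF; apply/derivable_mxP => i k; rewrite ord1.
by have [f' _ /(_ x)[]] := elementary_derive v (eF k).
Qed.

Lemma elementary_field_derive F v :
  elementary_field F -> elementary_field (fun x => 'D_v F x).
Proof.
move=> eF k; have [f' ef' df] := elementary_derive v (eF k).
suff -> : (fun x => 'D_v F x 0 k) = f' by [].
apply/funext => x; rewrite derive_mx ?mxE; last exact: elementary_field_derivable.
by case: (df x).
Qed.

Lemma row_continuous (F : 'rV[R]_m -> 'rV[R]_m) :
  (forall k, continuous (fun x => F x 0 k)) -> continuous F.
Proof.
move=> cF x; apply/(@cvgrPdist_le _ _ _ _ (nbhs_filter x)) => e e0.
have : \forall y \near x, forall k, `|F x 0 k - F y 0 k| <= e.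
  apply: (@filter_forall _ _ _ _ (nbhs_filter x)) => k.
  exact: ((@cvgrPdist_le _ _ _ _ (nbhs_filter x) _ _).1 (cF k x)).
apply: filterS => y Fxy.
rewrite [leLHS]/Num.Def.normr/= mx_normrE (bigmax_le _ (ltW e0))//= => -[i k] _.
by rewrite !mxE ord1.
Qed.

Lemma elementary_smooth F : elementary_field F -> smooth_field F.
Proof.
move=> eF js; have {}eF : elementary_field (iter_partial js F).
  by elim: js => //= j js; exact: elementary_field_derive.
split=> [|j x]; last exact: elementary_field_derivable.
by apply: row_continuous => k; apply: elementary_continuous.
Qed.

End Smooth.

(** * Piecewise constant controls *)

Section Realization.
Variables (R : realType) (m d : nat) (V : 'I_d -> 'rV[R]_m -> 'rV[R]_m).
Notation mu := (@lebesgue_measure R).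

(** [P] marks the coordinates that [F] does not move and that determine [F]; an empty [P] gives the
    constant fields. *)
Definition shear_field (F : 'rV[R]_m -> 'rV[R]_m) := exists P : pred 'I_m,
  (forall z k, P k -> F z 0 k = 0) /\
  (forall z z' : 'rV[R]_m, (forall k, P k -> z 0 k = z' 0 k) -> F z = F z').

Definition flow_step (p : 'I_d * R) z := z + p.2 *: V p.1 z.

Definition flow_seq (ps : seq ('I_d * R)) z := foldl (fun z p => flow_step p z) z ps.

Lemma shear_fieldK (F : 'rV[R]_m -> 'rV[R]_m) z s :
  shear_field F -> F (z + s *: F z) = F z.
Proof.
by move=> [P [F0 Fe]]; apply: Fe => k Pk; rewrite !mxE F0// mulr0 addr0.
Qed.

Lemma segment_finite_measure (a b : R) : (mu `[a, b]%classic < +oo)%E.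
Proof.
by rewrite /= lebesgue_measure_itv /= lte_fin; case: ifP => // _; rewrite -EFinB ltry.
Qed.

(** * Integrals of step functions *)

Section Step.
Variables (A : nat -> set R) (a : nat -> R) (n : nat) (D : set R).
Hypotheses (mA : forall j, measurable (A j)) (mD : measurable D).
Hypothesis finD : (mu D < +oo)%E.

Lemma indic_integrable (B : set R) : measurable B -> mu.-integrable D (EFin \o \1_B).
Proof.
move=> mB; apply: measurable_bounded_integrable => //.
exists 1; split; [exact: num_real|move=> M M1 x _ /=].
by rewrite indicE; case: (x \in B); rewrite ?normr1 ?normr0 ltW// (lt_trans _ M1).
Qed.

Lemma step_integrable :
  mu.-integrable D (EFin \o (fun s => \sum_(0 <= j < n) a j * \1_(A j) s)).
Proof.
elim: n => [|n' IH].
  rewrite (_ : _ \o _ = cst 0%E); first exact: integrable0.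
  by apply/funext => s /=; rewrite big_nil.
rewrite (_ : _ \o _ = (EFin \o (fun s => (\sum_(0 <= j < n') a j * \1_(A j) s)%R)
  \+ (fun s => (a n')%:E * (EFin \o \1_(A n')) s))%E).
  apply: integrableD => //; apply: integrableZl => //; exact: indic_integrable.
by apply/funext => s /=; rewrite big_nat_recr //= EFinD EFinM.
Qed.

End Step.

Lemma step_Rintegral (A : nat -> set R) (a : nat -> R) n (D : set R) :
  (forall j, measurable (A j)) -> measurable D -> (mu D < +oo)%E ->
  \int[mu]_(s in D) (\sum_(0 <= j < n) a j * \1_(A j) s) =
  \sum_(0 <= j < n) a j * fine (mu (A j `&` D)).
Proof.
move=> mA mD finD; elim: n => [|n IH].
  rewrite big_nil (_ : (fun _ => _) = cst 0); first by rewrite Rintegral_cst// mul0r.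
  by apply/funext => s; rewrite big_nil.
rewrite big_nat_recr //= -IH.
have -> : \int[mu]_(s in D) (\sum_(0 <= j < n.+1) a j * \1_(A j) s) =
    \int[mu]_(s in D) (\sum_(0 <= j < n) a j * \1_(A j) s + a n * \1_(A n) s).
  by apply: eq_Rintegral => s _; rewrite big_nat_recr.
rewrite RintegralD//; last 2 first.
- exact: step_integrable.
- rewrite (_ : _ \o _ = (fun s => (a n)%:E * (EFin \o \1_(A n)) s)%E).
    by apply: integrableZl => //; exact: indic_integrable.
  by apply/funext => s /=; rewrite EFinM.
congr (_ + _); rewrite RintegralZl//; last exact: indic_integrable.
by rewrite /Rintegral integral_indic //; exact: mA.
Qed.

(** * Existence and uniqueness of solutions for piecewise constant controls *)

Section Grid.
Variables (ps : nat -> 'I_d * R) (L : nat).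
Hypothesis L0 : (0 < L)%N.

Local Notation node j := (j%:R / L%:R : R).
Local Notation I j := ([set` `](node j), (node j.+1)]] : set R).
Local Notation c j := ((ps j).2 * L%:R).

Fixpoint flow_iter n (z : 'rV[R]_m) := if n is n'.+1 then flow_step (ps n') (flow_iter n' z) else z.

(** Move [j] occupies a cell of length [1/L], so speed [c j] covers the amount [(ps j).2]. Cells are
    open on the left: at time 0 every control vanishes. *)
Definition ctrl (i : 'I_d) (s : R) : R :=
  \sum_(0 <= j < L) (((ps j).1 == i)%:R * c j) * \1_(I j) s.

Let LR0 : 0 < L%:R :> R. Proof. by rewrite ltr0n. Qed.

Lemma indic_cell j l s : I l s -> \1_(I j) s = (j == l)%:R :> R.
Proof.
rewrite indicE /= !in_itv /= => /andP[ls sl].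
have [->|jl] := eqVneq j l; first by rewrite mem_set //= in_itv /= ls sl.
rewrite memNset //= in_itv /= => /andP[js sj].
have := lt_le_trans ls sj; have := lt_le_trans js sl.
rewrite !ltr_pM2r ?invr_gt0// !ltr_nat !ltnS => jl' lj.
by move/eqP: jl; apply; apply/eqP; rewrite eqn_leq jl' lj.
Qed.

Lemma cell_exists n s : 0 < s -> s <= node n -> exists2 l, (l < n)%N & I l s.
Proof.
move=> s0; elim: n => [|n IH]; first by rewrite mul0r leNgt s0.
move=> sn; have [/IH[l ln Il]|ns] := leP s (node n); first by exists l => //; exact: ltnW.
by exists n => //=; rewrite in_itv /= ns sn.
Qed.

Lemma ctrl_rhs_cell l s z : (l < L)%N -> I l s ->
  ctrl_rhs V ctrl s z = c l *: V (ps l).1 z.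
Proof.
move=> lL Il; rewrite /ctrl_rhs (bigD1 (ps l).1) //= big1 ?addr0.
  congr (_ *: _); rewrite /ctrl big_mkord (bigD1 (Ordinal lL)) //= big1 ?addr0.
    by rewrite (indic_cell _ Il) !eqxx mul1r mulr1.
  by move=> j jl; rewrite (indic_cell _ Il) (_ : (val j == l) = false) ?mulr0//; apply/negbTE.
move=> i il; rewrite /ctrl big1_seq ?scale0r// => j _.
rewrite (indic_cell _ Il); have [->|] := eqVneq j l; last by rewrite mulr0.
by rewrite eq_sym (negbTE il) !mul0r.
Qed.

Lemma ctrl_sq_integrable i : sq_integrable01 (ctrl i).
Proof.
have mctrl : measurable_fun `[(0:R), 1] (ctrl i).
  by apply: measurable_sum => j; apply: measurable_realfun.measurable_funM.
split=> //; apply: measurable_bounded_integrable => //.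
- exact: segment_finite_measure.
- exact: measurable_realfun.measurable_funX.
have bctrl s : `|ctrl i s| <= \sum_(0 <= j < L) `|((ps j).1 == i)%:R * c j|.
  apply: le_trans (ler_norm_sum _ _ _) _; apply: ler_sum => j _.
  rewrite normrM ler_piMr // indicE.
  by case: (_ \in _); rewrite ?normr1 ?normr0.
exists ((\sum_(0 <= j < L) `|((ps j).1 == i)%:R * c j|) ^+ 2).
split; [exact: num_real|move=> M M1 x _ /=].
by rewrite normrX (le_trans _ (ltW M1))// lerXn2r ?nnegrE// sumr_ge0.
Qed.

Hypothesis shearV : forall i, shear_field (V i).

Lemma flow_iter_sum n z :
  flow_iter n z = z + \sum_(0 <= j < n) (ps j).2 *: V (ps j).1 (flow_iter j z).
Proof.
elim: n => [|n IH]; first by rewrite big_nil addr0.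
by rewrite big_nat_recr //= addrA -IH.
Qed.

Lemma node_itv n : (n <= L)%N -> 0 <= node n <= 1.
Proof.
by move=> nL; rewrite divr_ge0//= ler_pdivrMr// mul1r ler_nat.
Qed.

(** On each cell a single shear field acts. The coordinates that determine it have zero right-hand
    side, so the field is constant along any solution and the integral equation can be evaluated. *)
Lemma solution_unique x X n : is_solution V ctrl x X -> (n <= L)%N ->
  X (node n) = flow_iter n x.
Proof.
move=> solX; elim: n => [_|n IH nL].
  apply/rowP => k; have [_ /(_ 0)] := solX k.
  by rewrite lexx ler01 mul0r set_itv1 Rintegral_set1 addr0; exact.
have {}IH := IH (ltnW nL); rewrite /= -IH.
have tn : node n <= node n.+1 by rewrite ler_pM2r ?invr_gt0// ler_nat.
have [t0n _] := andP (node_itv (ltnW nL)); have [_ tn1] := andP (node_itv nL).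
have step t k : node n <= t <= node n.+1 -> X t 0 k = X (node n) 0 k +
    \int[mu]_(s in `](node n), t]) (c n * V (ps n).1 (X s) 0 k).
  move=> /andP[nt tn']; have [intX eqX] := solX k.
  rewrite !eqX ?t0n ?(le_trans t0n nt) ?(le_trans tn' tn1) ?(le_trans tn tn1)//.
  rewrite -addrA; congr (_ + _).
  have -> : \int[mu]_(s in `](node n), t]) (c n * V (ps n).1 (X s) 0 k) =
            \int[mu]_(s in `](node n), t]) (ctrl_rhs V ctrl s (X s) 0 k).
    apply: eq_Rintegral => s; rewrite inE /= in_itv /= => /andP[ns st].
    by rewrite (@ctrl_rhs_cell n) ?mxE//= in_itv /= ns (le_trans st).
  rewrite -(@Rintegral_itvB _ _ (BLeft 0) (BRight t)) ?bnd_simp//.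
    by rewrite addrC subrK.
  apply: integrableS intX => //.
  by apply: subset_itvl; rewrite bnd_simp (le_trans tn' tn1).
have [P [V0 Ve]] := shearV (ps n).1.
have Xcst r : node n <= r <= node n.+1 -> V (ps n).1 (X r) = V (ps n).1 (X (node n)).
  move=> hr; apply: Ve => k Pk; rewrite (step r)//.
  have -> : \int[mu]_(s in `](node n), r]) (c n * V (ps n).1 (X s) 0 k) =
            \int[mu]_(s in `](node n), r]) 0.
    by apply: eq_Rintegral => s _; rewrite V0// mulr0.
  by rewrite Rintegral_cst// mul0r addr0.
apply/rowP => k; rewrite step ?lexx ?tn// !mxE; congr (_ + _).
have -> : \int[mu]_(s in `](node n), (node n.+1)]) (c n * V (ps n).1 (X s) 0 k) =
          \int[mu]_(s in `](node n), (node n.+1)]) (c n * V (ps n).1 (X (node n)) 0 k).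
  apply: eq_Rintegral => s; rewrite inE /= in_itv /= => /andP[ns st].
  by rewrite Xcst// (ltW ns).
rewrite Rintegral_cst//= lebesgue_measure_itv /= lte_fin.
rewrite ltr_pM2r ?invr_gt0// ltr_nat ltnSn -EFinB /= -mulrBl -natr1 addrC addKr.
by rewrite mul1r mulrAC mulfK// gt_eqF.
Qed.

Lemma cell_overlap j t : 0 <= t <= 1 ->
  fine (mu (I j `&` `[0, t])) = Num.max 0 (Num.min t (node j.+1) - node j).
Proof.
move=> /andP[t0 t1]; rewrite (_ : _ `&` _ = `](node j), (Num.min t (node j.+1))]%classic).
  rewrite /= lebesgue_measure_itv /= lte_fin; case: ltP => h.
    by rewrite -EFinB /= max_r// subr_ge0 ltW.
  by rewrite /= max_l// subr_le0.
have j0 : 0 <= node j by rewrite divr_ge0.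
apply/seteqP; split=> s /=; rewrite !in_itv /= le_min.
  by move=> [/andP[-> ->] /andP[_ ->]].
by move=> /and3P[js -> ->]; rewrite js (le_trans j0 (ltW js)).
Qed.

(* [Num.max 0 (Num.min t (node j.+1) - node j)] is the time spent in the
   [j]-th cell up to [t]. *)
Definition trajectory (x : 'rV[R]_m) (t : R) : 'rV[R]_m :=
  x + \sum_(0 <= j < L)
        (c j * Num.max 0 (Num.min t (node j.+1) - node j)) *: V (ps j).1 (flow_iter j x).

(** Cells before [l] contribute their full moves, which add up to [flow_iter l x]; cells after [l]
    contribute nothing. *)
Lemma trajectory_cell x l s : (l < L)%N -> I l s ->
  trajectory x s = flow_iter l x + (c l * (s - node l)) *: V (ps l).1 (flow_iter l x).
Proof.
move=> lL; rewrite /= in_itv /= => /andP[ls sl].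
rewrite /trajectory (big_cat_nat (n := l.+1)) //= [X in x + (_ + X)]big1_seq ?addr0.
  rewrite big_nat_recr //= flow_iter_sum addrA; congr (_ + _ + _).
    apply: eq_big_nat => j /andP[_ jl]; congr (_ *: _).
    have js : node j.+1 <= s.
      by apply: le_trans (ltW ls); rewrite ler_pM2r ?invr_gt0// ler_nat.
    rewrite min_r // -mulrBl -natr1 addrC addKr max_r ?divr_ge0//.
    by rewrite mulrA mulr1 mulfK// gt_eqF.
  by rewrite min_l// max_r// subr_ge0 ltW.
move=> j; rewrite mem_index_iota => /= /andP[lj _].
have sj : s <= node j by apply: le_trans sl _; rewrite ler_pM2r ?invr_gt0// ler_nat.
by rewrite max_l ?mulr0 ?scale0r// subr_le0 ge_min sj.
Qed.

(** Within a cell the field keeps its value from the start of the cell, so the right-hand side is a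
    step function of time. *)
Lemma trajectory_rhs x s k : 0 <= s <= 1 -> ctrl_rhs V ctrl s (trajectory x s) 0 k =
  \sum_(0 <= j < L) (c j * V (ps j).1 (flow_iter j x) 0 k) * \1_(I j) s.
Proof.
move=> /andP[s0 s1]; move: s0; rewrite le_eqVlt => /predU1P[<-|s0].
  have I0 j : \1_(I j) 0 = 0 :> R.
    rewrite indicE memNset //= in_itv /= => /andP[+ _].
    by rewrite ltNge divr_ge0.
  rewrite [RHS]big1 => [|j _]; last by rewrite I0 mulr0.
  rewrite /ctrl_rhs big1 ?mxE// => i _; rewrite /ctrl big1 ?scale0r// => j _.
  by rewrite I0 mulr0.
have [|l lL Il] := cell_exists (n := L) s0; first by rewrite divff// gt_eqF.
rewrite (ctrl_rhs_cell _ lL Il) (trajectory_cell _ lL Il) shear_fieldK// mxE.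
rewrite big_mkord (bigD1 (Ordinal lL)) //= (indic_cell _ Il) eqxx mulr1 big1 ?addr0//.
by move=> j jl; rewrite (indic_cell _ Il) (_ : (val j == l) = false) ?mulr0//; apply/negbTE.
Qed.

Lemma trajectory_solution x : is_solution V ctrl x (trajectory x).
Proof.
move=> k; split.
  have := @step_integrable _ (fun j => c j * V (ps j).1 (flow_iter j x) 0 k) L _
    (fun j => measurable_itv `](node j), (node j.+1)]) (measurable_itv `[0, 1])
    (segment_finite_measure 0 1).
  apply: eq_integrable => // s; rewrite inE /= in_itv /= => s01.
  by rewrite trajectory_rhs.
move=> t t01.
have -> : \int[mu]_(s in `[0, t]) (ctrl_rhs V ctrl s (trajectory x s) 0 k) =
   \int[mu]_(s in `[0, t]) (\sum_(0 <= j < L)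
    (c j * V (ps j).1 (flow_iter j x) 0 k) * \1_(I j) s).
  apply: eq_Rintegral => s; rewrite inE /= in_itv /= => /andP[s0 st].
  by rewrite trajectory_rhs// s0 (le_trans st)//; case/andP: t01.
rewrite step_Rintegral//.
  rewrite /trajectory mxE summxE; congr (_ + _); apply: eq_bigr => j _.
  by rewrite mxE cell_overlap// mulrAC.
exact: segment_finite_measure.
Qed.

Lemma flow_maps_to_flow_iter x : flow_maps_to V ctrl x (flow_iter L x).
Proof.
split; first by exists (trajectory x); exact: trajectory_solution.
by move=> X /solution_unique/(_ (leqnn L)); rewrite divff// gt_eqF.
Qed.

End Grid.
End Realization.

(** * Reachability of point configurations *)

Section Reachability.
Variables (R : realType) (m d : nat) (V : 'I_d -> 'rV[R]_m -> 'rV[R]_m).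
Hypothesis shearV : forall i, shear_field (V i).

(** One list of moves serves all points at once, as a common control must. *)
Definition reach (N : nat) (x y : 'I_N -> 'rV[R]_m) :=
  exists ps, forall i, flow_seq V ps (x i) = y i.

Variable N : nat.
Implicit Types x y z : 'I_N -> 'rV[R]_m.

Lemma reach_trans x y z : reach x y -> reach y z -> reach x z.
Proof.
move=> [ps xy] [qs yz]; exists (ps ++ qs) => i.
by rewrite /flow_seq foldl_cat -yz -xy.
Qed.

(** The moves are undone in reverse order with negated times, exactly because a shear field is
    constant along its own flow. *)
Lemma reach_sym x y : reach x y -> reach y x.
Proof.
move=> [ps xy]; exists (rev [seq (p.1, - p.2) | p <- ps]) => i; rewrite -xy.
elim: ps (x i) {xy} => //= p ps IH z.
rewrite rev_cons /flow_seq foldl_rcons -/(flow_seq _ _ _) IH /flow_step /=.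
by rewrite shear_fieldK// scaleNr addrK.
Qed.

Lemma reach_step i s x y : (forall l, y l = x l + s *: V i (x l)) -> reach x y.
Proof. by move=> xy; exists [:: (i, s)] => l; rewrite xy. Qed.

Lemma reach_refl x y : x =1 y -> reach x y.
Proof. by move=> xy; exists [::] => l; rewrite -xy. Qed.

Lemma flow_iter_nth p0 ps v :
  flow_iter V (nth p0 ps) (size ps) v = flow_seq V ps v.
Proof.
elim/last_ind: ps v => //= ps p IH v; rewrite size_rcons /= nth_rcons ltnn eqxx.
rewrite /flow_seq foldl_rcons -/(flow_seq _ _ _) -IH; congr flow_step.
have: (size ps <= size ps)%N by [].
elim: {1 3 4}(size ps) => //= n IHn nps.
by rewrite nth_rcons nps IHn// ltnW.
Qed.

Lemma reach_flow_maps_to (i0 : 'I_d) x y : reach x y ->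
  exists u, (forall j, sq_integrable01 (u j)) /\
    (forall i, flow_maps_to V u (x i) (y i)).
Proof.
(* The idle first move keeps the number of cells positive even when [ps] is empty. *)
move=> [ps xy]; pose qs := (i0, 0) :: ps.
exists (ctrl (nth (i0, 0) qs) (size qs)); split; first exact: ctrl_sq_integrable.
move=> i; suff -> : y i = flow_iter V (nth (i0, 0) qs) (size qs) (x i).
  exact: flow_maps_to_flow_iter.
by rewrite flow_iter_nth /= /flow_step /= scale0r addr0.
Qed.

End Reachability.

(** * Polynomial interpolation and avoidance of roots *)

Section Polynomials.
Variable R : realFieldType.

(** Newton interpolation: a new node is met by adding a multiple of the polynomial [P] that vanishes
    at the other nodes. *)
Lemma poly_interpolation (I : eqType) (s : seq I) (z v : I -> R) :
  (forall i j, z i = z j -> v i = v j) ->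
  exists q : {poly R}, forall i, i \in s -> q.[z i] = v i.
Proof.
move=> zv; elim: s => [|i s [q qv]]; first by exists 0.
have [/mapP[j js zij]|zi] := boolP (z i \in map z s).
  exists q => k; rewrite inE => /predU1P[->|/qv//].
  by rewrite zij qv//; apply: zv.
pose P := \prod_(j <- s) ('X - (z j)%:P).
have P0 : P.[z i] != 0.
  rewrite horner_prod prodf_seq_neq0; apply/allP => j js; apply/implyP => _.
  by rewrite hornerXsubC subr_eq0; apply: contraNneq zi => ->; exact: map_f.
exists (q + ((v i - q.[z i]) / P.[z i]) *: P) => k; rewrite inE hornerD hornerZ.
move=> /predU1P[->|ks]; first by rewrite mulfVK// addrC subrK.
rewrite [P.[z k]]horner_prod (big_rem k)//= hornerXsubC subrr mul0r mulr0 addr0.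
exact: qv.
Qed.

(** The product [Q] has fewer roots than its size, so one of [size Q] distinct points [e / (j + 2)]
    is not a root. *)
Lemma common_nonroot (I : finType) (P : pred I) (p : I -> {poly R}) e :
  0 < e -> (forall i, P i -> p i != 0) ->
  exists2 s, 0 < s < e & forall i, P i -> (p i).[s] != 0.
Proof.
move=> e0 p0; pose Q := \prod_(i | P i) p i.
have Q0 : Q != 0 by apply/prodf_neq0.
pose rs := [seq e / j.+2%:R | j <- iota 0 (size Q)].
have [/(max_poly_roots Q0)|/allPn[s /mapP[j _ ->{s}]]] := boolP (all (root Q) rs).
  rewrite size_map size_iota ltnn => /(_ _)/wrap[]//.
  rewrite map_inj_uniq ?iota_uniq// => a b /(mulfI (lt0r_neq0 e0))/invr_inj/eqP.
  by rewrite eqr_nat => /eqP[].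
rewrite rootE horner_prod => /prodf_neq0 ps; exists (e / j.+2%:R) => //.
by rewrite divr_gt0//= ltr_pdivrMr// ltr_pMr// ltr1n.
Qed.

End Polynomials.

(** * The fields and their transitivity *)

Section Fields.
Variables (R : realType) (n : nat) (C : R).
Local Notation m := n.+2.
Hypothesis C0 : 0 <= C.
Implicit Types v w : 'rV[R]_m.

(** The constants [c_k]: the translates of [[-C, C]] by different [c_k] are at distance at least
    1. *)
Definition spacing (k : 'I_m) : R := k%:R * (2 * C + 1).

Definition translation v : 'rV[R]_m := delta_mx 0 0.

Definition bump_shear v : 'rV[R]_m :=
  \row_k (if k == 0 then 0 else expR (- (v 0 0 + spacing k) ^+ 2)).

Definition radial v : R := expR (- \sum_(k | k != 0) v 0 k ^+ 2).

Definition radial_shear v : 'rV[R]_m := radial v *: delta_mx 0 0.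

(** Indices 0, 1, 2 carry T, A, B; indices 3 and 4 repeat B to make five. *)
Definition fields (i : 'I_5) : 'rV[R]_m -> 'rV[R]_m :=
  match val i with 0 => translation | 1 => bump_shear | _ => radial_shear end%N.

Lemma radial_itv v : 0 < radial v <= 1.
Proof.
rewrite expR_gt0 /radial expR_le1 oppr_le0 sumr_ge0// => k _; exact: sqr_ge0.
Qed.

Lemma fields_ind (P : ('rV[R]_m -> 'rV[R]_m) -> Prop) :
  P translation -> P bump_shear -> P radial_shear -> forall i, P (fields i).
Proof. by move=> PT PB PR [[|[|j]] jlt]. Qed.

Lemma fields_shear i : shear_field (fields i).
Proof.
apply: (fields_ind (P := @shear_field R m)).
- by exists pred0.
- exists (pred1 0); split=> [z k /eqP->|z z' zz']; first by rewrite mxE eqxx.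
  by apply/rowP => k; rewrite !mxE zz' //=.
- exists (predC1 0); split=> [z k /negbTE k0|z z' zz'].
    by rewrite !mxE k0 andbF mulr0.
  by congr (_ *: _); congr (expR (- _)); apply: eq_bigr => k k0; rewrite zz'.
Qed.

Lemma fields_bounded i : bounded_field (fields i).
Proof.
have bnd (F : 'rV[R]_m -> 'rV[R]_m) :
    (forall v k, `|F v 0 k| <= 1) -> bounded_field F.
  move=> F1; exists 1 => v; rewrite [leLHS]/Num.Def.normr/= mx_normrE.
  by apply: bigmax_le => // -[l k] _; rewrite ord1.
apply: (fields_ind (P := @bounded_field R m)); apply: bnd => v k; rewrite !mxE.
- by case: (_ && _); rewrite ?normr1 ?normr0.
- case: ifP => _; rewrite ?normr0// ger0_norm ?expR_ge0//.
  by rewrite expR_le1 oppr_le0 sqr_ge0.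
- have /andP[r0 r1] := radial_itv v.
  by case: (_ && _); rewrite ?mulr0 ?normr0// mulr1 gtr0_norm.
Qed.

Lemma fields_smooth i : smooth_field (fields i).
Proof.
apply: elementary_smooth; apply: (fields_ind (P := @elementary_field R m)) => k.
- exact: (elementary_cst _ ((delta_mx 0 0 : 'rV[R]_m) 0 k)).
- have [k0|k0] := eqVneq k 0.
    rewrite (_ : (fun v => bump_shear v 0 k) = cst 0); first exact: elementary_cst.
    by apply/funext => v; rewrite mxE k0.
  rewrite (_ : (fun v => bump_shear v 0 k) = expR \o (cst (-1) *
     (((fun v : 'rV[R]_m => v 0 0) + cst (spacing k)) *
      ((fun v : 'rV[R]_m => v 0 0) + cst (spacing k))))).
    apply: elementary_expR; apply: elementaryM; first exact: elementary_cst.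
    by apply: elementaryM; apply: elementaryD; (exact: elementary_coord || exact: elementary_cst).
  by apply/funext => v; rewrite mxE (negbTE k0) /= /GRing.mul /= mulN1r -expr2.
- rewrite (_ : (fun v => radial_shear v 0 k) = (expR \o (cst (-1) *
    \sum_(k : 'I_m | k != 0) ((fun v : 'rV[R]_m => v 0 k) * (fun v => v 0 k)))) *
    cst ((delta_mx 0 0 : 'rV[R]_m) 0 k)).
    apply: elementaryM; last exact: elementary_cst.
    apply: elementary_expR; apply: elementaryM; first exact: elementary_cst.
    by apply: elementary_sum => l; apply: elementaryM; exact: elementary_coord.
  apply/funext => v; rewrite mxE /radial; congr (expR _ * _).
  by rewrite /GRing.mul /= mulN1r fct_sumE.
Qed.

(** * Moving configurations of [N] points *)

Section Points.
Variable N : nat.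
Implicit Types x y z : 'I_N -> 'rV[R]_m.
Local Notation reach := (reach fields).

Lemma reach_translation s x y :
  (forall i, y i = x i + s *: delta_mx 0 0) -> reach x y.
Proof. exact: (@reach_step _ _ _ fields _ 0). Qed.

Lemma reach_radial s x y :
  (forall i, y i = x i + (s * radial (x i)) *: delta_mx 0 0) -> reach x y.
Proof.
move=> xy; apply: (@reach_step _ _ _ fields _ (@Ordinal 5 2 isT) s) => i.
by rewrite xy /fields /= /radial_shear scalerA.
Qed.

Lemma bump_shear_eq v w : v 0 0 = w 0 0 -> bump_shear v = bump_shear w.
Proof. by move=> vw; apply/rowP => k; rewrite !mxE vw. Qed.

Lemma reach_bump s r x y :
  (forall i, y i = x i + s *: bump_shear (x i + r *: delta_mx 0 0)) -> reach x y.
Proof.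
move=> xy; pose x1 i := x i + r *: delta_mx 0 0.
pose x2 i := x1 i + s *: bump_shear (x1 i).
apply: (@reach_trans _ _ _ _ _ _ x1); first exact: (reach_translation (s := r)).
apply: (@reach_trans _ _ _ _ _ _ x2).
  exact: (@reach_step _ _ _ fields _ (@Ordinal 5 1 isT) s).
apply: (reach_translation (s := - r)) => i.
by rewrite xy /x2 /x1 scaleNr addrAC addrK.
Qed.

(** Bump shears leave coordinate 0 unchanged, so every term may be evaluated at the starting
    point. *)
Lemma reach_bumps (s : nat -> R) L x y :
  (forall i, y i = x i +
    \sum_(j < L) s j *: bump_shear (x i + j%:R *: delta_mx 0 0)) -> reach x y.
Proof.
elim: L y => [|L IH] y xy; first by apply: reach_refl => i; rewrite xy big_ord0 addr0.
apply: (reach_trans (IH _ (fun i => erefl))).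
apply: (reach_bump (s := s L) (r := L%:R)) => i.
rewrite xy big_ord_recr /= addrA; congr (_ + _ *: _); apply: bump_shear_eq.
rewrite !mxE summxE big1 ?addr0// => j _.
by rewrite !mxE eqxx mulr0.
Qed.

(** Since [exp (-(b + j)^2) = exp (-b^2) exp (-j^2) exp (-2 b)^j], translated bumps with
    coefficients [q_j exp (j^2)] sum to [exp (-b^2) q(exp (-2 b))]. One polynomial [q] interpolates
    for all points and all coordinates together. *)
Lemma reach_shift x y :
  (forall i, `|x i 0 0| <= C) -> (forall i, y i 0 0 = x i 0 0) ->
  (forall i j, x i 0 0 = x j 0 0 -> y i - x i = y j - x j) -> reach x y.
Proof.
move=> xC y0 yx.
pose b (p : 'I_N * 'I_m) := x p.1 0 0 + spacing p.2.
pose z p := expR (- (2 * b p)).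
pose v (p : 'I_N * 'I_m) := (y p.1 - x p.1) 0 p.2 * expR (b p ^+ 2).
(* Equal nodes force equal coordinate indices by the spacing, then equal [x_0], then equal
   displacements by hypothesis. *)
have zv p p' : z p = z p' -> v p = v p'.
  move=> /expR_inj/oppr_inj/mulfI bb; have {}bb : b p = b p' by apply: bb.
  have {}ks : p.2 = p'.2.
    apply/val_inj/eqP; rewrite eqn_leq.
    have key (k l : nat) (s t : R) : `|s| <= C -> `|t| <= C ->
        s + k%:R * (2 * C + 1) = t + l%:R * (2 * C + 1) -> (k < l.+1)%N.
      move=> sC tC st; rewrite ltnNge; apply/negP; rewrite -(ler_nat R) -natr1.
      move: sC tC; rewrite !ler_norml => /andP[? ?] /andP[? ?] lk.
      have : (l%:R + 1) * (2 * C + 1) <= k%:R * (2 * C + 1).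
        by apply: ler_wpM2r => //; lra.
      lra.
    apply/andP; split; rewrite -ltnS; first exact: key (xC _) (xC _) bb.
    exact: key (xC _) (xC _) (esym bb).
  have x0 : x p.1 0 0 = x p'.1 0 0 by move: bb; rewrite /b ks; apply: addIr.
  by rewrite /v bb ks (yx _ _ x0).
have [q qv] := poly_interpolation (index_enum ('I_N * 'I_m)%type) zv.
apply: (reach_bumps (s := fun j => q`_j * expR (j%:R ^+ 2)) (L := size q)) => i.
apply/rowP => k; rewrite mxE summxE.
have [->|k0] := eqVneq k 0.
  by rewrite y0 big1 ?addr0// => j _; rewrite !mxE eqxx mulr0.
have -> : \sum_(j < size q) ((q`_j * expR (j%:R ^+ 2)) *:
    bump_shear (x i + j%:R *: delta_mx 0 0)) 0 k = v (i, k) * expR (- b (i, k) ^+ 2).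
  rewrite -qv ?mem_index_enum// horner_coef mulr_suml; apply: eq_bigr => j _.
  rewrite !mxE (negbTE k0) eqxx /= -!mulrA -expRM_natr -!expRD.
  by congr (_ * expR _); rewrite /b /=; ring.
by rewrite /v /= -mulrA -expRD subrr expR0 mulr1 !mxE addrC subrK.
Qed.

(** Points that share [x_0] differ in their tails; a generic [t] gives them different values of
    [radial], and a generic time [s < 1] of the radial shear then separates all first coordinates.
    Each moves by at most 1, whence [B + 1 <= C]. *)
Lemma reach_separate B x : injective x -> (forall i, `|x i 0 0| <= B) -> B + 1 <= C ->
  exists y, [/\ reach x y, (forall i j, y i 0 0 = y j 0 0 -> i = j) &
    forall i, `|y i 0 0| <= C].
Proof.
move=> xinj xB BC.
(* After shifting the tails by [(t ^+ k)_k], the difference of the squared norms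
   of the tails of points [i] and [j] is the value of [diffp (i, j)] at [t]. *)
pose diffp (p : 'I_N * 'I_N) : {poly R} := \sum_(k < m | k != 0)
  ((x p.1 0 k ^+ 2 - x p.2 0 k ^+ 2)%:P + (2 * (x p.1 0 k - x p.2 0 k)) *: 'X^k).
pose tail_neq (p : 'I_N * 'I_N) := [exists k, (k != 0) && (x p.1 0 k != x p.2 0 k)].
have diffp0 p : tail_neq p -> diffp p != 0.
  move=> /existsP[k /andP[k0 xk]]; apply/eqP => /polyP/(_ k).
  rewrite coef_sum coef0 (bigD1 k)//= big1 => [|l /andP[_ lk]].
    rewrite coefD coefC coefZ coefXn eqxx (_ : (k == 0 :> nat) = false); last exact: negbTE.
    by rewrite add0r mulr1 => /eqP; rewrite addr0 mulf_eq0 pnatr_eq0 subr_eq0 (negbTE xk).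
  rewrite coefD coefC coefZ coefXn (_ : (k == 0 :> nat) = false); last exact: negbTE.
  by rewrite (_ : (k == l :> nat) = false) ?mulr0 ?addr0// eq_sym; exact: negbTE.
have [t _ tP] := common_nonroot ltr01 diffp0.
pose y1 i := x i + \row_k (if k == 0 then 0 else t ^+ k).
have xy1 : reach x y1.
  apply: reach_shift => [i|i|i j _]; last by rewrite /y1 !(addrC (x _)) !addrK.
    by rewrite (le_trans (xB i)) //; lra.
  by rewrite /y1 !mxE addr0.
have radial_inj i j : x i 0 0 = x j 0 0 -> radial (y1 i) = radial (y1 j) -> i = j.
  move=> x0 /expR_inj/oppr_inj ry; apply: xinj; apply/rowP => k.
  have [->//|k0] := eqVneq k 0; apply/eqP; apply: contraT => xk.
  have /(tP (i, j)) : tail_neq (i, j) by apply/existsP; exists k; rewrite k0.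
  have -> : (diffp (i, j)).[t] =
      \sum_(k | k != 0) y1 i 0 k ^+ 2 - \sum_(k | k != 0) y1 j 0 k ^+ 2.
    rewrite /diffp horner_sum -sumrB; apply: eq_bigr => l l0.
    by rewrite hornerD hornerC hornerZ hornerXn !mxE (negbTE l0) /=; ring.
  by rewrite ry subrr eqxx.
(* The value of [sep (i, j)] at [s] is the difference of the first coordinates after time [s] of the
   radial shear. *)
pose sep (p : 'I_N * 'I_N) : {poly R} := (x p.1 0 0 - x p.2 0 0)%:P +
  (radial (y1 p.1) - radial (y1 p.2)) *: 'X.
have sep0 p : p.1 != p.2 -> sep p != 0.
  move=> pp; apply/eqP => /polyP sepE; have := sepE 0%N; have := sepE 1%N.
  rewrite !coefD !coefC !coefZ !coefX /= mulr1 mulr0 addr0 add0r.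
  move=> /eqP; rewrite subr_eq0 => /eqP r12 /eqP; rewrite subr_eq0 => /eqP x12.
  by move/eqP: pp; apply; exact: radial_inj.
have [s /andP[s0 s1] sP] := common_nonroot ltr01 sep0.
exists (fun i => y1 i + (s * radial (y1 i)) *: delta_mx 0 0); split.
- by apply: (reach_trans xy1); apply: (reach_radial (s := s)).
- move=> i j; rewrite !mxE /= !addr0 !mulr1 => yij; apply/eqP; apply: contraT => ij.
  have := sP (i, j) ij; rewrite hornerD hornerC hornerZ hornerX => /eqP[].
  by move: yij => /=; lra.
- move=> i; rewrite !mxE /= addr0 mulr1.
  have /andP[r0 r1] := radial_itv (y1 i).
  have : 0 <= s * radial (y1 i) <= 1 by rewrite mulr_ge0 ?mulr_ile1 ?(ltW s0) ?(ltW s1) ?(ltW r0).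
  by have := xB i; rewrite !ler_norml; lra.
Qed.

(** Distinct first coordinates leave the tails free. They are set so that time [2 D] of the radial
    shear and a translation by [-D] bring each [x_0] to its target, and are then corrected to those
    of [y]. *)
Lemma reach_connect x y :
  (forall i j, x i 0 0 = x j 0 0 -> i = j) -> (forall i, `|x i 0 0| <= C) ->
  (forall i j, y i 0 0 = y j 0 0 -> i = j) -> (forall i, `|y i 0 0| <= C) ->
  reach x y.
Proof.
move=> xinj xC yinj yC; pose D := 2 * C + 1.
have D0 : 0 < D by rewrite ltr_wpDl// mulr_ge0.
(* [v i] solves [x_0 + 2 D v - D = y_0]; it lies in [(0, 1)] because [|y_0 - x_0| <= 2 C < D]. *)
pose v i := (y i 0 0 - x i 0 0 + D) / (2 * D).
have v01 i : 0 < v i < 1.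
  have /[!ler_norml]/andP[? ?] := xC i; have /[!ler_norml]/andP[? ?] := yC i.
  by rewrite divr_gt0 ?ltr_pdivrMr ?mul1r ?mulr_gt0//; rewrite /D; lra.
(* A single tail entry, at coordinate 1 ([lift ord0 ord0]), suffices to give [radial] the value
   [v i]. *)
pose x1 i : 'rV[R]_m := \row_k (if k == 0 then x i 0 0 else
  if k == lift ord0 ord0 then Num.sqrt (- ln (v i)) else 0).
have rx1 i : radial (x1 i) = v i.
  have /andP[v0 v1] := v01 i.
  rewrite /radial (bigD1 (lift ord0 ord0))//= big1 => [|k /andP[k0 k1]].
    by rewrite mxE /= addr0 sqr_sqrtr ?oppr_ge0 ?ln_le0 ?ltW// opprK lnK// posrE.
  by rewrite mxE (negbTE k0) (negbTE k1) expr0n.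
pose x2 i := x1 i + (2 * D * radial (x1 i)) *: delta_mx 0 0.
pose x3 i := x2 i + (- D) *: delta_mx 0 0.
have x30 i : x3 i 0 0 = y i 0 0.
  rewrite !mxE /= rx1 /v !mulr1 mulrC divfK; last by rewrite mulf_neq0 ?gt_eqF.
  by lra.
apply: (@reach_trans _ _ _ _ _ _ x1).
  apply: reach_shift => // [i|i j /xinj->//]; by rewrite mxE.
apply: (@reach_trans _ _ _ _ _ _ x2); first exact: (reach_radial (s := 2 * D)).
apply: (@reach_trans _ _ _ _ _ _ x3); first exact: (reach_translation (s := - D)).
apply: reach_shift => [i|i|i j].
- by rewrite x30; exact: yC.
- by rewrite x30.
- move=> x3ij; have /yinj -> // : y i 0 0 = y j 0 0.
  exact: etrans (esym (x30 i)) (etrans x3ij (x30 j)).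
Qed.

End Points.
End Fields.

Theorem theorem1 (R : realType) (m : nat) (hm : (2 <= m)%N)
  (Omega : set 'rV[R]_m) (hopen : open Omega) (hbdd : bounded_set Omega)
  (hconn : connected Omega) :
  exists V : 'I_5 -> 'rV[R]_m -> 'rV[R]_m,
    (forall i, smooth_field (V i) /\ bounded_field (V i)) /\
    (forall N : nat, universal_interpolator V Omega N).
Proof.
case: m hm Omega hopen hbdd hconn => [|[|n]]// _ Omega _ [M [_ OM]] _.
(* Boundedness provides a norm bound by any number strictly above [M]. The fields use [C = B + 1],
   the extra unit being room for the separation. *)
pose B := `|M| + 1; have C0 : 0 <= B + 1 by rewrite /B !addr_ge0.
have OB v : Omega v -> `|v 0 0| <= B.
  move=> Ov; have := OM B _ v Ov.
  have -> : M < B by rewrite /B (le_lt_trans (ler_norm M))// ltrDl.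
  move=> /(_ isT); apply: le_trans.
  rewrite [leRHS]/Num.Def.normr/= mx_normrE.
  exact: (le_bigmax _ (fun i : 'I_1 * 'I_n.+2 => `|v i.1 i.2|) (0, 0)).
exists (fields (B + 1)); split=> [i|N x y Ox Oy xinj yinj].
  by split; [exact: fields_smooth|exact: fields_bounded].
(* Both configurations are separated, the separated ones are connected, and the moves from [y] are
   run backwards. *)
have [x' [xx' x'inj x'C]] := reach_separate xinj (fun i => OB _ (Ox i)) (lexx _).
have [y' [yy' y'inj y'C]] := reach_separate yinj (fun i => OB _ (Oy i)) (lexx _).
have shearV := @fields_shear R n (B + 1).
apply: (reach_flow_maps_to shearV ord0); apply: (reach_trans xx').
apply: (reach_trans _ (reach_sym shearV yy')).
exact: reach_connect.
Qed.
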